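(* The third-order scalar PDE in two independent variables $$\mathcal E:=\{u_{xxy}\,u_{yyy}-u_{xyy}^2=0\}\subseteq J^3(\mathbb R^3,2)$$ is not contact-equivalent to a quasi-linear (third-order) PDE.
   Context: $J^k(\mathbb R^3,2)$ is the manifold of $k$-jets of $2$-dimensional submanifolds of $\mathbb R^3$. In the standard chart (jets of graphs $u=u(x,y)$), $J^2$ has coordinates $(x,y,u,u_x,u_y,u_{xx},u_{xy},u_{yy})$, and $J^3$ has the additional coordinates $u_{xxx},u_{xxy},u_{xyy},u_{yyy}$. The Cartan distribution $\mathcal C$ on $J^2$ is defined by the vanishing of the forms $du-u_xdx-u_ydy$, $du_x-u_{xx}dx-u_{xy}dy$, $du_y-u_{xy}dx-u_{yy}dy$. The fibre of $\pi:J^3\to J^2$ over $\theta$ is identified with the set of $2$-dimensional horizontal (i.e. transversal to the fibres of $J^2\to J^1$) integral elements of $\mathcal C_\theta$. A contact transformation is a diffeomorphism $\Phi:U\to V$ between nonempty open subsets $U,V$ of (the standard chart of) $J^2(\mathbb R^3,2)$ which preserves the Cartan distribution; acting on horizontal $2$-dimensional integral elements it lifts to a diffeomorphism $\Phi^{(1)}:\pi^{-1}(U)\to\pi^{-1}(V)$. A PDE $\mathcal E$ is contact-equivalent to a PDE $\mathcal E'$ if there is such a $\Phi$ with $\Phi^{(1)}(\mathcal E\cap\pi^{-1}(U))=\mathcal E'\cap\pi^{-1}(V)$. A third-order PDE $\mathcal E'$ is quasi-linear if it is of the form $\{A u_{xxx}+B u_{xxy}+C u_{xyy}+D u_{yyy}+F=0\}$,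 where $A,B,C,D,F$ are smooth functions on (an open subset of) $J^2$ and $A,B,C,D$ have no common zero. *)

(* Defs.v *)
From HB Require Import structures.
From mathcomp Require Import all_boot all_order all_algebra.
From mathcomp Require Import all_classical all_reals.
From mathcomp Require Import topology normedtype derive.
From mathcomp Require Import ring.

Set Implicit Arguments.
Unset Strict Implicit.
Unset Printing Implicit Defensive.

Import Order.TTheory GRing.Theory Num.Theory.
Import numFieldNormedType.Exports.

Local Open Scope classical_set_scope.
Local Open Scope ring_scope.

(* Only meaningful for U open, where derivatives at points of U do not depend
   on the (junk) values of f outside U. *)
Fixpoint Ck_on (R : realType) (V W : normedModType R) (k : nat)
    (U : set V) (f : V -> W) : Prop :=
  match k with
  | 0 => forall x, U x -> {for x, continuous f}
  | k'.+1 => (forall x, U x -> differentiable f x) /\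
             (forall v : V, Ck_on k' U ('D_v f))
  end.

Definition smooth_on (R : realType) (V W : normedModType R)
    (U : set V) (f : V -> W) : Prop :=
  forall k : nat, Ck_on k U f.

(* The standard chart of J^2(R^3,2), with coordinates
   (x, y, u, u_x, u_y, u_xx, u_xy, u_yy).  The type serves both for points and
   for tangent vectors; the value on a tangent vector xi of the coordinate
   1-form dx is  xi 0 ix,  etc. *)
Notation J2 R := 'rV[R]_8.

Definition ix   : 'I_8 := @Ordinal 8 0 isT.
Definition iy   : 'I_8 := @Ordinal 8 1 isT.
Definition iu   : 'I_8 := @Ordinal 8 2 isT.
Definition iux  : 'I_8 := @Ordinal 8 3 isT.
Definition iuy  : 'I_8 := @Ordinal 8 4 isT.
Definition iuxx : 'I_8 := @Ordinal 8 5 isT.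
Definition iuxy : 'I_8 := @Ordinal 8 6 isT.
Definition iuyy : 'I_8 := @Ordinal 8 7 isT.

(* The standard chart of J^3(R^3,2): a point of J^2 together with
   (u_xxx, u_xxy, u_xyy, u_yyy); the projection J^3 -> J^2 is fst. *)
Notation J3 R := ('rV[R]_8 * 'rV[R]_4)%type.

Section Jets.
Variable R : realType.
Implicit Types (th xi eta : J2 R) (p : J3 R) (W : {vspace (J2 R)}).

Definition uxxx p : R := p.2 0 (@Ordinal 4 0 isT).
Definition uxxy p : R := p.2 0 (@Ordinal 4 1 isT).
Definition uxyy p : R := p.2 0 (@Ordinal 4 2 isT).
Definition uyyy p : R := p.2 0 (@Ordinal 4 3 isT).

(* du - u_x dx - u_y dy, du_x - u_xx dx - u_xy dy, du_y - u_xy dx - u_yy dy *)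
Definition form_u  th xi : R :=
  xi 0 iu - th 0 iux * xi 0 ix - th 0 iuy * xi 0 iy.
Definition form_ux th xi : R :=
  xi 0 iux - th 0 iuxx * xi 0 ix - th 0 iuxy * xi 0 iy.
Definition form_uy th xi : R :=
  xi 0 iuy - th 0 iuxy * xi 0 ix - th 0 iuyy * xi 0 iy.

Definition cartan th : set (J2 R) :=
  [set xi | [/\ form_u th xi = 0, form_ux th xi = 0 & form_uy th xi = 0]].

Definition wedge (i j : 'I_8) xi eta : R :=
  xi 0 i * eta 0 j - eta 0 i * xi 0 j.

(* The exterior derivatives of the three forms; as they have constant
   coefficients there is no dependence on the base point. *)
Definition dform_u  xi eta : R := wedge ix iux xi eta + wedge iy iuy xi eta.
Definition dform_ux xi eta : R := wedge ix iuxx xi eta + wedge iy iuxy xi eta.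
Definition dform_uy xi eta : R := wedge ix iuxy xi eta + wedge iy iuyy xi eta.

Definition integral_element th W : Prop :=
  (forall xi, xi \in W -> cartan th xi) /\
  (forall xi eta, xi \in W -> eta \in W ->
     [/\ dform_u xi eta = 0, dform_ux xi eta = 0 & dform_uy xi eta = 0]).

(* tangent to the fibres of J^2 -> J^1 *)
Definition vertical xi : Prop :=
  [/\ xi 0 ix = 0, xi 0 iy = 0, xi 0 iu = 0, xi 0 iux = 0 & xi 0 iuy = 0].

Definition horizontal W : Prop :=
  forall xi, xi \in W -> vertical xi -> xi = 0.

(* The total derivatives D_x and D_y, truncated to J^2. *)
Definition Dx p : J2 R :=
  \row_(i < 8) [:: 1; 0; p.1 0 iux; p.1 0 iuxx; p.1 0 iuxy;
                   uxxx p; uxxy p; uxyy p]`_i.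
Definition Dy p : J2 R :=
  \row_(i < 8) [:: 0; 1; p.1 0 iuy; p.1 0 iuxy; p.1 0 iuyy;
                   uxxy p; uxyy p; uyyy p]`_i.

(* The integral element of the Cartan distribution at p.1 corresponding to p;
   elt_ofP and elt_of_inj below show that this identifies the fibre of
   J^3 -> J^2 with the set of horizontal 2-dimensional integral elements. *)
Definition elt_of p : {vspace (J2 R)} := (<[Dx p]> + <[Dy p]>)%VS.

Lemma elt_ofE p xi : (xi \in elt_of p) <->
  xi = xi 0 ix *: Dx p + xi 0 iy *: Dy p.
Proof.
split=> [/memv_addP[a /vlineP[k ->] [b /vlineP[l ->] ->]]|->].
  by rewrite !mxE /= !(mulr1, mulr0) addr0 add0r.
by apply: memv_add; apply: memvZ; exact: memv_line.
Qed.

Lemma J2_eq xi eta :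
  xi 0 ix = eta 0 ix -> xi 0 iy = eta 0 iy -> xi 0 iu = eta 0 iu ->
  xi 0 iux = eta 0 iux -> xi 0 iuy = eta 0 iuy -> xi 0 iuxx = eta 0 iuxx ->
  xi 0 iuxy = eta 0 iuxy -> xi 0 iuyy = eta 0 iuyy -> xi = eta.
Proof.
move=> h0 h1 h2 h3 h4 h5 h6 h7; apply/rowP => -[[|[|[|[|[|[|[|[|//]]]]]]]] Hi];
by [rewrite (_ : Ordinal Hi = ix) //; apply: val_inj
   |rewrite (_ : Ordinal Hi = iy) //; apply: val_inj
   |rewrite (_ : Ordinal Hi = iu) //; apply: val_inj
   |rewrite (_ : Ordinal Hi = iux) //; apply: val_inj
   |rewrite (_ : Ordinal Hi = iuy) //; apply: val_inj
   |rewrite (_ : Ordinal Hi = iuxx) //; apply: val_inj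
   |rewrite (_ : Ordinal Hi = iuxy) //; apply: val_inj
   |rewrite (_ : Ordinal Hi = iuyy) //; apply: val_inj].
Qed.


Lemma elt_of_inj th (a b : 'rV[R]_4) :
  elt_of (th, a) = elt_of (th, b) -> a = b.
Proof.
move=> eab.
have /elt_ofE : Dx (th, a) \in elt_of (th, b).
  by rewrite -eab -[Dx _]addr0; apply: memv_add; rewrite ?mem0v ?memv_line.
have /elt_ofE : Dy (th, a) \in elt_of (th, b).
  by rewrite -eab -[Dy _]add0r; apply: memv_add; rewrite ?mem0v ?memv_line.
rewrite /Dx /Dy !mxE /= !(scale1r, scale0r, addr0, add0r) => ey ex.
apply/rowP => -[[|[|[|[|//]]]] Hi].
- move/rowP/(_ iuxx): ex; rewrite !mxE /= /uxxx /=.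
  by rewrite (_ : Ordinal Hi = @Ordinal 4 0 isT) //; apply: val_inj.
- move/rowP/(_ iuxy): ex; rewrite !mxE /= /uxxy /=.
  by rewrite (_ : Ordinal Hi = @Ordinal 4 1 isT) //; apply: val_inj.
- move/rowP/(_ iuyy): ex; rewrite !mxE /= /uxyy /=.
  by rewrite (_ : Ordinal Hi = @Ordinal 4 2 isT) //; apply: val_inj.
- move/rowP/(_ iuyy): ey; rewrite !mxE /= /uyyy /=.
  by rewrite (_ : Ordinal Hi = @Ordinal 4 3 isT) //; apply: val_inj.
Qed.

Lemma elt_ofP th W :
  [/\ \dim W = 2, integral_element th W & horizontal W] <->
  exists a : 'rV[R]_4, W = elt_of (th, a).
Proof.
pose g (j : 'I_2) : 'I_8 := if j == 0 then ix else iy.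
pose h : 'Hom(J2 R, 'rV[R]_2) := linfun (colsub g : J2 R -> 'rV[R]_2).
have hE xi j : h xi 0 j = xi 0 (g j) by rewrite lfunE /= !mxE.
have ker0 W' : (forall xi, xi \in W' -> cartan th xi) -> horizontal W' ->
    (W' :&: lker h = 0)%VS.
  move=> intW hor; apply/eqP; rewrite -subv0; apply/subvP => xi.
  rewrite memv_cap memv_ker memv0 => /andP[Wxi /eqP hxi].
  have x0 : xi 0 ix = 0 by rewrite -(hE xi 0) hxi mxE.
  have y0 : xi 0 iy = 0 by rewrite -(hE xi 1) hxi mxE.
  have [] := intW _ Wxi.
  rewrite /form_u /form_ux /form_uy x0 y0 !mulr0 !subr0 => u0 ux0 uy0.
  by apply/eqP/hor.
split.
- move=> [dimW [cW iW] hor].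
  have hW : (h @: W = fullv)%VS.
    apply/eqP; rewrite eqEdim subvf /= limg_dim_eq ?ker0 //.
    by rewrite dimW dimvf dim_matrix.
  have pre (v : 'rV[R]_2) : exists2 xi, xi \in W & h xi = v.
    have : v \in (h @: W)%VS by rewrite hW memvf.
    by move/memv_imgP => [xi Wxi ->]; exists xi.
  have [e1 We1 he1] := pre (delta_mx 0 0).
  have [e2 We2 he2] := pre (delta_mx 0 1).
  have e1x : e1 0 ix = 1 by rewrite -(hE e1 0) he1 mxE.
  have e1y : e1 0 iy = 0 by rewrite -(hE e1 1) he1 mxE.
  have e2x : e2 0 ix = 0 by rewrite -(hE e2 0) he2 mxE.
  have e2y : e2 0 iy = 1 by rewrite -(hE e2 1) he2 mxE.
  have [c1 c2 c3] := cW _ We1; have [d1 d2 d3] := cW _ We2.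
  have [_ i2 i3] := iW _ _ We1 We2.
  move: c1 c2 c3 d1 d2 d3 i2 i3.
  rewrite /form_u /form_ux /form_uy /dform_ux /dform_uy /wedge.
  rewrite !(e1x, e1y, e2x, e2y) !(mulr0, mulr1, mul0r, mul1r, subr0, sub0r).
  move=> /eqP; rewrite subr_eq0 => /eqP c1.
  move=> /eqP; rewrite subr_eq0 => /eqP c2.
  move=> /eqP; rewrite subr_eq0 => /eqP c3.
  move=> /eqP; rewrite subr_eq0 => /eqP d1.
  move=> /eqP; rewrite subr_eq0 => /eqP d2.
  move=> /eqP; rewrite subr_eq0 => /eqP d3.
  move=> /eqP; rewrite subr_eq0 => /eqP i2.
  move=> /eqP; rewrite subr_eq0 => /eqP i3.
  pose a : 'rV[R]_4 :=
    \row_(i < 4) [:: e1 0 iuxx; e1 0 iuxy; e1 0 iuyy; e2 0 iuyy]`_i.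
  exists a.
  have De1 : e1 = Dx (th, a).
    by apply: J2_eq; rewrite !mxE /= /uxxx /uxxy /uxyy ?mxE.
  have De2 : e2 = Dy (th, a).
    by apply: J2_eq; rewrite !mxE /= /uxxy /uxyy /uyyy ?mxE.
  apply/vspaceP => xi; apply/idP/idP => [Wxi|/elt_ofE ->]; last first.
    by rewrite -De1 -De2 rpredD ?rpredZ.
  apply/elt_ofE; rewrite -De1 -De2; apply/eqP; rewrite -subr_eq0.
  rewrite -memv0 -(ker0 W cW hor) memv_cap memv_ker.
  rewrite rpredB ?rpredD ?rpredZ //=; apply/eqP/rowP => j.
  rewrite hE !mxE /g; case: ifP => _.
    by rewrite e1x e2x mulr1 mulr0 addr0 subrr.
  by rewrite e1y e2y mulr1 mulr0 add0r subrr.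
- move=> [a ->].
  have ca xi : xi \in elt_of (th, a) -> cartan th xi.
    move=> /elt_ofE ->; rewrite /cartan /= /form_u /form_ux /form_uy !mxE /=.
    by split; ring.
  have hor : horizontal (elt_of (th, a)).
    by move=> xi /elt_ofE xiE [x0 y0 _ _ _]; rewrite xiE x0 y0 !scale0r addr0.
  split=> //; last first.
    split=> // xi eta /elt_ofE -> /elt_ofE ->.
    rewrite /dform_u /dform_ux /dform_uy /wedge !mxE /=.
    by split; ring.
  rewrite -(limg_dim_eq (ker0 _ ca hor)) (_ : (h @: _)%VS = fullv).
    by rewrite dimvf dim_matrix.
  apply/vspaceP => v; rewrite memvf; apply/memv_imgP.
  exists (v 0 0 *: Dx (th, a) + v 0 1 *: Dy (th, a)).
    by apply/elt_ofE; rewrite !mxE /= !(mulr1, mulr0) addr0 add0r.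
  apply/rowP => j; rewrite hE /g.
  case: j => [[|[|//]]] Hj; rewrite !mxE /= !(mulr1, mulr0) ?addr0 ?add0r;
    by congr (v _ _); apply: val_inj.
Qed.

(* A contact transformation Phi : U -> V, represented by a function on the
   whole chart whose values outside U play no role. *)
Definition contact_transformation (U V : set (J2 R)) (Phi : J2 R -> J2 R) :
    Prop :=
  [/\ open U /\ U !=set0, open V /\ V !=set0,
      smooth_on U Phi,
      exists Psi : J2 R -> J2 R,
        [/\ smooth_on V Psi,
            forall th, U th -> V (Phi th) /\ Psi (Phi th) = th &
            forall th, V th -> U (Psi th) /\ Phi (Psi th) = th] &
      forall th, U th -> 'd Phi th @` cartan th = cartan (Phi th)].

(* The action of Phi on pairs (point of J^2, subspace of the tangent space);
   its restriction to horizontal integral elements is Phi^(1). *)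
Definition lift (Phi : J2 R -> J2 R) (e : J2 R * {vspace (J2 R)}) :
    J2 R * {vspace (J2 R)} :=
  (Phi e.1, (linfun ('d Phi (e.1)) @: e.2)%VS).

(* The intersection of E with the preimage of U, as a set of integral
   elements. *)
Definition elts_over (U : set (J2 R)) (E : set (J3 R)) :
    set (J2 R * {vspace (J2 R)}) :=
  [set (p.1, elt_of p) | p in E `&` fst @^-1` U].

Definition contact_equivalent (E E' : set (J3 R)) : Prop :=
  exists U V Phi, contact_transformation U V Phi /\
    lift Phi @` elts_over U E = elts_over V E'.

Definition quasi_linear (E : set (J3 R)) : Prop :=
  exists (O : set (J2 R)) (A B C D F : J2 R -> R),
    [/\ open O,
        [/\ smooth_on O (A : _ -> R^o), smooth_on O (B : _ -> R^o),
            smooth_on O (C : _ -> R^o), smooth_on O (D : _ -> R^o) &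
            smooth_on O (F : _ -> R^o)],
        forall th, O th -> ~ [/\ A th = 0, B th = 0, C th = 0 & D th = 0] &
        E = [set p | O p.1 /\
               A p.1 * uxxx p + B p.1 * uxxy p + C p.1 * uxyy p
               + D p.1 * uyyy p + F p.1 = 0]].

End Jets.

(* Main.v *)
From HB Require Import structures.
Require Import Defs.
From mathcomp Require Import all_boot all_order all_algebra.
From mathcomp Require Import all_classical all_reals.
From mathcomp Require Import topology normedtype derive.
From mathcomp Require Import ring lra.

Set Implicit Arguments.
Unset Strict Implicit.
Unset Printing Implicit Defensive.

Import Order.TTheory GRing.Theory Num.Theory.
Import numFieldNormedType.Exports.

Local Open Scope classical_set_scope.
Local Open Scope ring_scope.

(* Let Phi be an equivalence of E with a quasi-linear equation, T its
   differential at a point th and S the inverse of T.  The fibre of E over th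
   is a line times the cone bd = c^2, so it is singular at the origin, while
   the fibre of the quasi-linear equation over Phi th contains an affine
   3-space through the image of the origin.  Moving along this 3-space and
   applying S gives, to first order, an injective linear map from a
   3-dimensional space into the tangent cone {bd = c^2} of E at the origin,
   which contains no 3-dimensional linear subspace. *)

(** * Preliminaries: differentials of local inverses, kernels, first-order limits *)

Lemma diff_cancel_on (R : realType) (V W : normedModType R)
    (U : set V) (f : V -> W) (g : W -> V) (x : V) :
  open U -> U x -> {in U, cancel f g} ->
  differentiable f x -> differentiable g (f x) ->
  cancel ('d f x) ('d g (f x)).
Proof.
move=> Uo Ux fgK df dg v.
rewrite -[LHS]/(('d g (f x) \o 'd f x) v) -diff_comp //.
rewrite -deriveE; last exact: differentiable_comp.
rewrite -[RHS](derive_id x v); apply: near_eq_derive.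
by apply: filterS (open_nbhs_nbhs (conj Uo Ux)) => y Uy; apply/fgK/mem_set.
Qed.

Lemma linear_ker_neq0 (F : fieldType) m n (f : 'rV[F]_m -> 'rV[F]_n) :
  linear f -> (n < m)%N -> exists2 h, h != 0 & f h = 0.
Proof.
move=> lf nm.
pose g : {linear 'rV[F]_m -> 'rV[F]_n} :=
  HB.pack f (GRing.isLinear.Build F _ _ *:%R f lf).
have : kermx (lin1_mx g) != 0.
  rewrite kermx_eq0 -row_leq_rank -ltnNge.
  exact: leq_ltn_trans (rank_leq_col _) nm.
rewrite -nz_row_eq0 => h0; exists (nz_row (kermx (lin1_mx g))) => //.
by rewrite -[f _]/(g _) -mul_rV_lin1; apply/sub_kermxP/nz_row_sub.
Qed.

(* By Cramer's rule (a, b, c, d) is, up to the factor t / det, an affine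
   function of t; the relations between its entries are thus polynomial of
   degree at most 2 in t, so their values at t = 0 are determined by those at
   t = 1, 2, 3. *)
Lemma cone_limit (R : realFieldType)
    (p1 p2 q1 q2 s0 s1 s5 s6 s7 r0 r1 r5 r6 r7 : R) :
  (forall t, exists a b c d,
    b * d - c ^+ 2 = 0 /\
    [/\ t * s5 = (p1 + t * s0) * a + (p2 + t * s1) * b,
        t * s6 = (p1 + t * s0) * b + (p2 + t * s1) * c &
        t * s7 = (p1 + t * s0) * c + (p2 + t * s1) * d] /\
    [/\ t * r5 = (q1 + t * r0) * a + (q2 + t * r1) * b,
        t * r6 = (q1 + t * r0) * b + (q2 + t * r1) * c &
        t * r7 = (q1 + t * r0) * c + (q2 + t * r1) * d]) ->
  [/\ p1 * r5 - q1 * s5 = s6 * q2 - r6 * p2,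
      p1 * r6 - q1 * s6 = s7 * q2 - r7 * p2 &
      (p1 * r5 - q1 * s5) * (p1 * r7 - q1 * s7) = (p1 * r6 - q1 * s6) ^+ 2].
Proof.
move=> H.
have {}H t : t != 0 ->
  [/\ (p1 + t * s0) * r5 - (q1 + t * r0) * s5 =
        s6 * (q2 + t * r1) - r6 * (p2 + t * s1),
      (p1 + t * s0) * r6 - (q1 + t * r0) * s6 =
        s7 * (q2 + t * r1) - r7 * (p2 + t * s1) &
      ((p1 + t * s0) * r5 - (q1 + t * r0) * s5) *
        ((p1 + t * s0) * r7 - (q1 + t * r0) * s7) =
        ((p1 + t * s0) * r6 - (q1 + t * r0) * s6) ^+ 2].
  move=> t0; have [a [b [c [d [K [[x5 x6 x7] [y5 y6 y7]]]]]]] := H t.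
  set P1 := p1 + t * s0 in x5 x6 x7 *; set P2 := p2 + t * s1 in x5 x6 x7 *.
  set Q1 := q1 + t * r0 in y5 y6 y7 *; set Q2 := q2 + t * r1 in y5 y6 y7 *.
  pose det := P1 * Q2 - P2 * Q1.
  have cramer_l u v y z : t * u = P1 * y + P2 * z -> t * v = Q1 * y + Q2 * z ->
      t * (u * Q2 - v * P2) = det * y.
    by move=> eu ev; rewrite mulrBr !mulrA eu ev /det; ring.
  have cramer_r u v y z : t * u = P1 * y + P2 * z -> t * v = Q1 * y + Q2 * z ->
      t * (P1 * v - Q1 * u) = det * z.
    by move=> eu ev; rewrite mulrBr !(mulrCA t) eu ev /det; ring.
  have e5 := cramer_r _ _ _ _ x5 y5; have e6 := cramer_r _ _ _ _ x6 y6.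
  have e7 := cramer_r _ _ _ _ x7 y7.
  split; apply: (mulfI t0).
  - by rewrite e5 (cramer_l _ _ _ _ x6 y6).
  - by rewrite e6 (cramer_l _ _ _ _ x7 y7).
  apply: (mulfI t0); move/eqP: K; rewrite subr_eq0 => /eqP K.
  transitivity ((t * (P1 * r5 - Q1 * s5)) * (t * (P1 * r7 - Q1 * s7))).
    by ring.
  transitivity ((t * (P1 * r6 - Q1 * s6)) ^+ 2); last by ring.
  by rewrite e5 e6 e7 mulrACA K exprMn.
have n1 : 1 != 0 :> R by rewrite oner_eq0.
have n2 : 2 != 0 :> R by rewrite pnatr_eq0.
have n3 : 3 != 0 :> R by rewrite pnatr_eq0.
have [a1 b1 c1] := H 1 n1; have [a2 b2 c2] := H 2 n2; have [_ _ c3] := H 3 n3.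
by split; lra.
Qed.

(** * Translations in the fibre of $J^3\to J^2$ as vertical tangent vectors *)

Section VerticalLifts.
Variable R : realType.
Implicit Types (h a : 'rV[R]_4) (th : J2 R).

(** The derivatives of [Dx] and [Dy] along the fibre direction [h]. The base point [0 : J2 R] is a
    dummy: the third-order coordinates read only the second component. *)
Definition vert_x h : J2 R :=
  \row_(i < 8) [:: 0; 0; 0; 0; 0; uxxx (0 : J2 R, h); uxxy (0 : J2 R, h);
                   uxyy (0 : J2 R, h)]`_i.
Definition vert_y h : J2 R :=
  \row_(i < 8) [:: 0; 0; 0; 0; 0; uxxy (0 : J2 R, h); uxyy (0 : J2 R, h);
                   uyyy (0 : J2 R, h)]`_i.

Lemma vert_x_linear : linear vert_x.
Proof.
move=> k h h'.
by apply: J2_eq; rewrite !mxE /= /uxxx /uxxy /uxyy ?mxE ?mulr0 ?addr0.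
Qed.

Lemma vert_y_linear : linear vert_y.
Proof.
move=> k h h'.
by apply: J2_eq; rewrite !mxE /= /uyyy /uxxy /uxyy ?mxE ?mulr0 ?addr0.
Qed.

Lemma DxD th a h k : Dx (th, a + k *: h) = Dx (th, a) + k *: vert_x h.
Proof.
by apply: J2_eq; rewrite !mxE /= /uxxx /uxxy /uxyy /= ?mxE ?mulr0 ?addr0.
Qed.

Lemma DyD th a h k : Dy (th, a + k *: h) = Dy (th, a) + k *: vert_y h.
Proof.
by apply: J2_eq; rewrite !mxE /= /uyyy /uxxy /uxyy /= ?mxE ?mulr0 ?addr0.
Qed.

Lemma cartan_vert_x th h : cartan th (vert_x h).
Proof. by rewrite /cartan /= /form_u /form_ux /form_uy !mxE /= !mulr0 !subr0. Qed.

Lemma cartan_vert_y th h : cartan th (vert_y h).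
Proof. by rewrite /cartan /= /form_u /form_ux /form_uy !mxE /= !mulr0 !subr0. Qed.

Lemma Dx_elt_of (p : J3 R) : Dx p \in elt_of p.
Proof. by rewrite -[Dx p]addr0 memv_add ?mem0v ?memv_line. Qed.

Lemma Dy_elt_of (p : J3 R) : Dy p \in elt_of p.
Proof. by rewrite -[Dy p]add0r memv_add ?mem0v ?memv_line. Qed.

Lemma elt_of_coord (th xi : J2 R) (a : 'rV[R]_4) : xi \in elt_of (th, a) ->
  [/\ xi 0 iuxx = xi 0 ix * uxxx (th, a) + xi 0 iy * uxxy (th, a),
      xi 0 iuxy = xi 0 ix * uxxy (th, a) + xi 0 iy * uxyy (th, a) &
      xi 0 iuyy = xi 0 ix * uxyy (th, a) + xi 0 iy * uyyy (th, a)].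
Proof. by move=> /elt_ofE xiE; split; rewrite {1}xiE !mxE. Qed.

(** The three Cartan equations express the first-order part of [xi] through its x and y components,
    exactly as in [Dx] and [Dy] at the origin of the fibre. *)
Lemma elt_of0 (th xi : J2 R) : cartan th xi ->
  xi 0 iuxx = 0 -> xi 0 iuxy = 0 -> xi 0 iuyy = 0 -> xi \in elt_of (th, 0).
Proof.
move=> [/eqP c1 /eqP c2 /eqP c3] x5 x6 x7; apply/elt_ofE.
move: c1 c2 c3; rewrite /form_u /form_ux /form_uy -!addrA -!opprD !subr_eq0.
move=> /eqP c1 /eqP c2 /eqP c3.
apply: J2_eq; rewrite !mxE /= /uxxx /uxxy /uxyy /uyyy /= ?mxE
  ?(x5, x6, x7, c1, c2, c3) ?(mulr0, mulr1, addr0, add0r) //;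
  by congr (_ + _); rewrite mulrC.
Qed.

Lemma vert_eq0 (h : 'rV[R]_4) : vert_x h = 0 -> vert_y h = 0 -> h = 0.
Proof.
move=> /rowP vx /rowP vy; apply/rowP => -[[|[|[|[|//]]]] Hi].
- by have := vx iuxx; rewrite !mxE /= /uxxx /= => <-; congr (h _ _); apply: val_inj.
- by have := vx iuxy; rewrite !mxE /= /uxxy /= => <-; congr (h _ _); apply: val_inj.
- by have := vx iuyy; rewrite !mxE /= /uxyy /= => <-; congr (h _ _); apply: val_inj.
- by have := vy iuyy; rewrite !mxE /= /uyyy /= => <-; congr (h _ _); apply: val_inj.
Qed.

End VerticalLifts.

(** * The linear-algebra obstruction *)

(** The first four equations exhibit a left inverse of the matrix with rows [(p1, p2)] and
    [(q1, q2)]; the last two say that its adjugate kills the column [(u, v)]. *)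
Lemma rank2_ker_trivial (R : fieldType) (p1 p2 q1 q2 m1 m2 n1 n2 u v : R) :
  m1 * p1 + m2 * q1 = 1 -> m1 * p2 + m2 * q2 = 0 ->
  n1 * p1 + n2 * q1 = 0 -> n1 * p2 + n2 * q2 = 1 ->
  u * q2 - v * p2 = 0 -> p1 * v - q1 * u = 0 -> u = 0 /\ v = 0.
Proof.
move=> mp mq np nq uv vu.
have det1 : (m1 * n2 - m2 * n1) * (p1 * q2 - p2 * q1) = 1.
  transitivity ((m1 * p1 + m2 * q1) * (n1 * p2 + n2 * q2)
    - (m1 * p2 + m2 * q2) * (n1 * p1 + n2 * q1)); first by ring.
  by rewrite mp mq np nq; ring.
have det0 : p1 * q2 - p2 * q1 != 0.
  by apply/eqP => d0; move/eqP: det1; rewrite d0 mulr0 eq_sym oner_eq0.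
split; apply: (mulfI det0); rewrite mulr0.
  transitivity (p1 * (u * q2 - v * p2) + p2 * (p1 * v - q1 * u)); first by ring.
  by rewrite uv vu; ring.
transitivity (q1 * (u * q2 - v * p2) + q2 * (p1 * v - q1 * u)); first by ring.
by rewrite uv vu; ring.
Qed.

Lemma no_flat_image_of_cone (R : realType) (T S : {linear J2 R -> J2 R})
    (th th' : J2 R) (a' : 'rV[R]_4) (L : 'rV[R]_4 -> 'rV[R]_1) :
  cancel T S -> T @` cartan th = cartan th' ->
  (linfun T @: elt_of (th, 0%R) = elt_of (th', a'))%VS ->
  linear L ->
  (forall h, L h = 0 -> exists2 a,
     uxxy (th, a) * uyyy (th, a) - uxyy (th, a) ^+ 2 = 0 &
     (linfun T @: elt_of (th, a) = elt_of (th', a' + h)%R)%VS) -> False.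
Proof.
move=> TK Tcartan T0 lL Tcone.
have back a b xi : (linfun T @: elt_of (th, a) = elt_of (th', b))%VS ->
    xi \in elt_of (th', b) -> S xi \in elt_of (th, a).
  by move=> <- /memv_imgP[y ya ->]; rewrite lfunE /= TK.
have forth a b xi : (linfun T @: elt_of (th, a) = elt_of (th', b))%VS ->
    xi \in elt_of (th, a) -> T xi \in elt_of (th', b).
  by move=> <- xia; rewrite -[T xi](lfunE T) memv_img.
have Scartan xi : cartan th' xi -> cartan th (S xi) /\ T (S xi) = xi.
  by rewrite -Tcartan => -[y cy <-]; rewrite TK.
(* [X] and [Y] span the plane at the origin of the fibre over [th], so their second-order components
   vanish. *)
set X := S (Dx (th', a')); set Y := S (Dy (th', a')).
have [X5 X6 X7] := elt_of_coord (back _ _ _ T0 (Dx_elt_of _)).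
have [Y5 Y6 Y7] := elt_of_coord (back _ _ _ T0 (Dy_elt_of _)).
move: X5 X6 X7 Y5 Y6 Y7.
rewrite /uxxx /uxxy /uxyy /uyyy /= !mxE !mulr0 !addr0 -/X -/Y.
move=> X5 X6 X7 Y5 Y6 Y7.
pose sx h := S (vert_x h); pose sy h := S (vert_y h).
(* Up to a determinant, the differences below are the first-order changes of $u_{xxy}$, $u_{xyy}$,
   $u_{yyy}$ as the image moves along [a' + t *: h]. *)
have cone_h h : L h = 0 ->
  [/\ X 0 ix * sy h 0 iuxx - Y 0 ix * sx h 0 iuxx =
        sx h 0 iuxy * Y 0 iy - sy h 0 iuxy * X 0 iy,
      X 0 ix * sy h 0 iuxy - Y 0 ix * sx h 0 iuxy =
        sx h 0 iuyy * Y 0 iy - sy h 0 iuyy * X 0 iy &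
      (X 0 ix * sy h 0 iuxx - Y 0 ix * sx h 0 iuxx) *
        (X 0 ix * sy h 0 iuyy - Y 0 ix * sx h 0 iuyy) =
        (X 0 ix * sy h 0 iuxy - Y 0 ix * sx h 0 iuxy) ^+ 2].
  move=> Lh0; apply: (@cone_limit _ _ _ _ _ (sx h 0 ix) (sx h 0 iy) _ _ _
    (sy h 0 ix) (sy h 0 iy)) => t.
  have Lth : L (t *: h) = 0.
    pose L' : {linear 'rV[R]_4 -> 'rV[R]_1} :=
      HB.pack L (GRing.isLinear.Build R _ _ *:%R L lL).
    by have := linearZ_LR L' t h; rewrite /= Lh0 scaler0.
  have [a conea Ta] := Tcone _ Lth.
  exists (uxxx (th, a)), (uxxy (th, a)), (uxyy (th, a)), (uyyy (th, a)).
  split=> //.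
  have := elt_of_coord (back _ _ _ Ta (Dx_elt_of _)).
  have := elt_of_coord (back _ _ _ Ta (Dy_elt_of _)).
  rewrite DxD DyD !linearD !linearZ /= -/X -/Y -/(sx h) -/(sy h).
  have addE (u v : J2 R) (c : R) i : (u + c *: v) 0 i = u 0 i + c * v 0 i.
    by rewrite !mxE.
  by rewrite !addE X5 X6 X7 Y5 Y6 Y7 !add0r.
(* Three linear conditions on a 4-dimensional space: [h] lies in the kernel of [L], the change of
   $u_{xxx}$ vanishes, and [beta + delta = 0]. The last makes [beta * delta - gamma ^+ 2] negative
   definite in [beta], [gamma], so all changes vanish. *)
pose f h : 'rV[R]_3 := \row_(i < 3)
  [:: L h 0 0; sx h 0 iuxx * Y 0 iy - sy h 0 iuxx * X 0 iy;
      (X 0 ix * sy h 0 iuxx - Y 0 ix * sx h 0 iuxx) +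
      (X 0 ix * sy h 0 iuyy - Y 0 ix * sx h 0 iuyy)]`_i.
have lf : linear f.
  move=> k h h'; apply/rowP => i.
  have sxE : sx (k *: h + h') = k *: sx h + sx h'.
    by rewrite /sx vert_x_linear linearP.
  have syE : sy (k *: h + h') = k *: sy h + sy h'.
    by rewrite /sy vert_y_linear linearP.
  rewrite !mxE lL sxE syE.
  have addE n (u v : 'rV[R]_n) (c : R) j : (c *: u + v) 0 j = c * u 0 j + v 0 j.
    by rewrite !mxE.
  by rewrite !addE; case: i => [[|[|[|//]]] Hi] /=; ring.
have [h /negP h0 /rowP fh0] := linear_ker_neq0 lf isT.
have Lh0 : L h = 0.
  by apply/rowP => i; have := fh0 0; rewrite !mxE /= ord1.
have := fh0 1; rewrite !mxE /= => alpha0.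
have := fh0 (@Ordinal 3 2 isT); rewrite !mxE /= => trace0.
have [betaE gammaE coneE] := cone_h _ Lh0.
move: betaE gammaE coneE trace0.
set beta := X 0 ix * sy h 0 iuxx - _.
set gamma := X 0 ix * sy h 0 iuxy - _.
set delta := X 0 ix * sy h 0 iuyy - _.
move=> betaE gammaE coneE trace0.
have deltaE : delta = - beta by apply/eqP; rewrite -addr_eq0 addrC trace0.
have /andP[/eqP beta0 /eqP gamma0] : (beta == 0) && (gamma == 0).
  rewrite -[_ == 0]sqrf_eq0 -[X in _ && X]sqrf_eq0 -paddr_eq0 ?sqr_ge0 //.
  by rewrite -coneE deltaE mulrN expr2 subrr.
have delta0 : delta = 0 by rewrite deltaE beta0 oppr0.
(* Expanding [Dx] and [Dy] in [X] and [Y] inverts the matrix of their x and y components, as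
   [rank2_ker_trivial] requires. *)
have span xi : xi \in elt_of (th, 0) -> exists m1 m2, xi = m1 *: X + m2 *: Y.
  move=> /(forth _ _ _ T0) /elt_ofE Txi; exists (T xi 0 ix), (T xi 0 iy).
  by rewrite -[LHS]TK {1}Txi linearD !linearZ.
have [m1 [m2 mE]] := span _ (Dx_elt_of _).
have [n1 [n2 nE]] := span _ (Dy_elt_of _).
have ker0 := @rank2_ker_trivial R (X 0 ix) (X 0 iy) (Y 0 ix) (Y 0 iy) m1 m2 n1 n2.
have {}ker0 u v : u * Y 0 iy - v * X 0 iy = 0 -> X 0 ix * v - Y 0 ix * u = 0 ->
    u = 0 /\ v = 0.
  apply: ker0.
  - by move/rowP/(_ ix): mE; rewrite !mxE /= => <-.
  - by move/rowP/(_ iy): mE; rewrite !mxE /= => <-.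
  - by move/rowP/(_ ix): nE; rewrite !mxE /= => <-.
  - by move/rowP/(_ iy): nE; rewrite !mxE /= => <-.
have [sx5 sy5] := ker0 _ _ alpha0 beta0.
have [sx6 sy6] := ker0 _ _ (etrans (esym betaE) beta0) gamma0.
have [sx7 sy7] := ker0 _ _ (etrans (esym gammaE) gamma0) delta0.
have [csx Tsx] := Scartan _ (cartan_vert_x th' h).
have [csy Tsy] := Scartan _ (cartan_vert_y th' h).
(* The vectors [vert_x h] and [vert_y h] now lie in the horizontal plane [elt_of (th', a')]; having
   zero x and y components, they vanish. *)
apply: h0; apply/eqP/vert_eq0.
  have := forth _ _ _ T0 (elt_of0 csx sx5 sx6 sx7).
  by rewrite Tsx => /elt_ofE ->; rewrite !mxE /= !scale0r addr0.
have := forth _ _ _ T0 (elt_of0 csy sy5 sy6 sy7).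
by rewrite Tsy => /elt_ofE ->; rewrite !mxE /= !scale0r addr0.
Qed.

(** * Reduction to the differential at one point *)

Theorem mainTheorem3 (R : realType) :
  ~ exists E' : set (J3 R),
      quasi_linear E' /\
      contact_equivalent
        [set p : J3 R | uxxy p * uyyy p - uxyy p ^+ 2 = 0] E'.
Proof.
move=> [_ [[O [A [B [C [D [F [_ _ _ ->]]]]]]] [U [V [Phi [ct liftE]]]]]].
case: ct => -[Uo [th Uth]] _ Phis [Psi [Psis PhiK _]] Phic.
have [Vth _] := PhiK _ Uth.
have [dPhi _] := Phis 1; have [dPsi _] := Psis 1.
have dK : cancel ('d Phi th) ('d Psi (Phi th)).
  apply: (diff_cancel_on Uo Uth); [|exact: dPhi|exact: dPsi].
  by move=> y /set_mem /PhiK[].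
(* The linear part of the quasi-linear equation over [Phi th]; translating a solution by its kernel
   gives solutions. *)
pose L (h : 'rV[R]_4) : 'rV[R]_1 :=
  const_mx (A (Phi th) * uxxx (th, h) + B (Phi th) * uxxy (th, h)
            + C (Phi th) * uxyy (th, h) + D (Phi th) * uyyy (th, h)).
have lL : linear L.
  move=> k h h'; apply/rowP => i.
  by rewrite !mxE /uxxx /uxxy /uxyy /uyyy /= !mxE; ring.
(* The vertex [(th, 0)] of the cone satisfies the equation, so its lift is some [(Phi th, a')]. *)
have [[th' a'] [[/= Oth' eqa'] _] [thE T0]] : elts_over V
    [set p | O p.1 /\ A p.1 * uxxx p + B p.1 * uxxy p + C p.1 * uxyy p
               + D p.1 * uyyy p + F p.1 = 0] (Defs.lift Phi (th, elt_of (th, 0))).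
  rewrite -liftE; exists (th, elt_of (th, 0)) => //; exists (th, 0) => //.
  by split=> //=; rewrite /uxxy /uxyy /uyyy /= !mxE mul0r expr2 mul0r subrr.
subst th'.
apply: (no_flat_image_of_cone dK (Phic _ Uth) (esym T0) lL) => h Lh0.
have : elts_over V
    [set p | O p.1 /\ A p.1 * uxxx p + B p.1 * uxxy p + C p.1 * uxyy p
               + D p.1 * uyyy p + F p.1 = 0]
    (Phi th, elt_of (Phi th, a' + h)).
  exists (Phi th, a' + h) => //; split=> //=; split=> //.
  move/rowP/(_ 0): Lh0 => /=; rewrite !mxE => Lh0.
  rewrite -[RHS]addr0 -{2}Lh0 -eqa' /uxxx /uxxy /uxyy /uyyy /= !mxE; ring.
rewrite -liftE => -[_ [[th1 a] [/= conea Uth1] <-] [/= thE Ta]].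
(* The preimage lies over the same point because [Phi] is injective on [U]. *)
have th1E : th1 = th.
  by rewrite -(PhiK _ Uth).2 -thE (PhiK _ Uth1).2.
by subst th1; exists a.
Qed.
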